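(* For every $d\geq 1$, the logic $\mathsf{C}^{(0,d+1)}$ identifies every colored graph of tree-depth at most $d$; that is, for every colored graph $G$ with $\operatorname{td}(G)\leq d$ and every colored graph $H$ not isomorphic to $G$, there is a sentence of $\mathsf{C}^{(0,d+1)}$ that holds in exactly one of $G$ and $H$.
   Context: Colored graphs are finite simple graphs with a vertex coloring; isomorphisms preserve edges, non-edges and colors. First-order logic with counting $\mathsf{C}$ has atomic formulas $x=y$, $E(x,y)$, $U_c(x)$, Boolean connectives, and quantifiers $\forall,\exists,\exists^{\geq n}$ ($n\in\mathbb{N}$). A variable $x$ is requantified in $\varphi$ if it is both free and bound in $\varphi$, or $\varphi$ has a subformula $Qx\,\psi$ where $\psi$ has a subformula $Q'x\,\chi$ ($Q,Q'$ quantifiers). $\mathsf{C}^{(0,k)}$ is the set of $\mathsf{C}$-formulas with variables in $\{y_1,\dots,y_k\}$ in which no variable is requantified. Tree-depth: if $G_1,\dots,G_p$ are the connected components of $G$, then $\operatorname{td}(G)=1$ if $|V(G)|=1$; $\operatorname{td}(G)=1+\min_{v\in V(G)}\operatorname{td}(G-v)$ if $p=1$ and $|V(G)|>1$; and $\operatorname{td}(G)=\max_{i\in[p]}\operatorname{td}(G_i)$ otherwise. *)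

(* Defs.v *)
From mathcomp Require Import all_boot.
Set Implicit Arguments.
Unset Strict Implicit.
Unset Printing Implicit Defensive.

Record cgraph (C : eqType) := CGraph {
  vertex :> finType;
  edge : rel vertex;
  color : vertex -> C;
  edge_sym : symmetric edge;
  edge_irr : irreflexive edge
}.

Definition isomorphic (C : eqType) (G H : cgraph C) : Prop :=
  exists f : G -> H,
    [/\ bijective f,
        forall u v, edge (f u) (f v) = edge u v &
        forall u, color (f u) = color u].

Section TreeDepth.
Variables (C : eqType) (G : cgraph C).
Implicit Types A B : {set G}.

(* Subgraphs of G are represented by their vertex sets: A stands for G[A]. *)
Definition edge_in A : rel G :=
  [rel u v | [&& u \in A, v \in A & edge u v]].

Definition components A : {set {set G}} :=
  equivalence_partition (connect (edge_in A)) A.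

(* The recursion is on n, and n = #|A| steps always suffice. The default value
   #|A| of the minimum is never attained, as td (G[A] - v) <= #|A| - 1.
   The recursion equations are td_set_card1, td_set_connected and
   td_set_components below. *)
Fixpoint td_rec (n : nat) A : nat :=
  if n is m.+1 then
    if #|A| == 1 then 1
    else if #|components A| == 1 then
      (\big[minn/#|A|]_(v in A) td_rec m (A :\ v)).+1
    else \max_(B in components A) td_rec m B
  else 0.

Definition td_set A : nat := td_rec #|A| A.

Lemma edge_in_sym A : connect_sym (edge_in A).
Proof.
by apply: sym_connect_sym => u v; rewrite /edge_in /= edge_sym andbCA.
Qed.

Lemma edge_in_equiv A :
  {in A & &, equivalence_rel (connect (edge_in A))}.
Proof.
move=> x y z _ _ _; split; first exact: connect0.
by move=> xy; apply: (same_connect (@edge_in_sym A)).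
Qed.

Lemma components_partition A : partition (components A) A.
Proof. exact/equivalence_partitionP/edge_in_equiv. Qed.

Lemma components_proper A B :
  #|components A| != 1 -> B \in components A -> B \proper A.
Proof.
move=> n1 BC; have partA := components_partition A.
have [/eqP covA /trivIsetP trA n0] := and3P partA.
have BA : B \subset A by rewrite -covA; apply: (bigcup_sup B).
rewrite properEneq BA andbT; apply: contra n1 => /eqP eBA; apply/cards1P.
exists B; apply/setP => D; rewrite inE; apply/idP/eqP => [DC|->//].
apply/eqP; apply: contraT => nDB.
have := trA _ _ DC BC nDB; rewrite eBA disjoints_subset => sD.
have DA : D \subset A by rewrite -covA; apply: (bigcup_sup D).
have D0 : D = set0.
  by apply/eqP; rewrite -subset0 -(setICr A) subsetI DA.
by rewrite -D0 DC in n0.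
Qed.

Lemma components_set0 : components set0 = set0.
Proof. by rewrite /components /equivalence_partition imset0. Qed.

Lemma td_rec_fuel m n A : #|A| <= m -> #|A| <= n -> td_rec m A = td_rec n A.
Proof.
elim: m n A => [|m IH] [|n] A //= Am An.
- move: Am; rewrite leqn0 cards_eq0 => /eqP ->.
  by rewrite components_set0 !cards0 /= big_set0.
- move: An; rewrite leqn0 cards_eq0 => /eqP ->.
  by rewrite components_set0 !cards0 /= big_set0.
case: ifP => // _; case: ifP => [_|/negbT n1].
  congr _.+1; apply: eq_bigr => v vA.
  by apply: IH; rewrite -ltnS; apply: leq_trans (proper_card (properD1 vA)) _.
apply: eq_bigr => B BA; have pB := proper_card (components_proper n1 BA).
by apply: IH; rewrite -ltnS; apply: leq_trans pB _.
Qed.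

Lemma td_set0 : td_set set0 = 0.
Proof. by rewrite /td_set cards0. Qed.

Lemma td_set_rec A : A != set0 ->
  td_set A = if #|A| == 1 then 1
    else if #|components A| == 1 then
      (\big[minn/#|A|]_(v in A) td_set (A :\ v)).+1
    else \max_(B in components A) td_set B.
Proof.
rewrite -card_gt0 {1}/td_set => A0.
rewrite -(prednK A0) /= (prednK A0).
case: ifP => // _; case: ifP => [_|/negbT n1].
  congr _.+1; apply: eq_bigr => v vA; apply: td_rec_fuel => //.
  by rewrite -ltnS prednK //; apply: proper_card (properD1 vA).
apply: eq_bigr => B BA; apply: td_rec_fuel => //.
by rewrite -ltnS prednK //; apply: proper_card (components_proper n1 BA).
Qed.

Lemma bigmin_le (B : {set G}) (F : G -> nat) k v :
  v \in B -> \big[minn/k]_(u in B) F u <= F v.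
Proof.
move=> vB; elim: (index_enum G) (mem_index_enum v) => //= a s IH.
rewrite inE big_cons => /orP[/eqP<-|/IH le]; first by rewrite vB geq_minl.
by case: ifP => // _; apply: leq_trans le; apply: geq_minr.
Qed.

Lemma bigmin_attained (B : {set G}) (F : G -> nat) k v :
  v \in B -> F v <= k ->
  exists2 u, u \in B & \big[minn/k]_(u in B) F u = F u.
Proof.
move=> vB Fk; set m := \big[_/_]_(_ in _) _.
have : m <= F v by apply: bigmin_le.
have [->|//] : m = k \/ exists2 u, u \in B & m = F u; last first.
  by move=> kF; exists v => //; apply/eqP; rewrite eqn_leq kF.
rewrite /m; elim/big_rec: _ => [|u n uB IH]; first by left.
by rewrite /minn; case: ifP => _ //; right; exists u.
Qed.

Lemma td_set_le A : td_set A <= #|A|.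
Proof.
elim: {A}#|A| {-2}A (leqnn #|A|) => [|n IH] A An.
  by move: An; rewrite leqn0 cards_eq0 => /eqP ->; rewrite td_set0.
have [->|A0] := eqVneq A set0; first by rewrite td_set0.
rewrite td_set_rec //; case: eqP => [->//|_]; case: eqP => [_|/eqP n1].
  have [v vA] := set0Pn _ A0; have := cardsD1 v A; rewrite vA add1n => cA.
  rewrite cA ltnS; apply: leq_trans (bigmin_le _ _ vA) (IH _ _).
  by rewrite -ltnS -cA.
apply/bigmax_leqP => B BA; have pB := proper_card (components_proper n1 BA).
by apply: leq_trans (IH _ _) (ltnW pB); rewrite -ltnS (leq_trans pB).
Qed.

Lemma td_set_card1 A : #|A| = 1 -> td_set A = 1.
Proof. by move=> A1; rewrite td_set_rec ?A1 // -card_gt0 A1. Qed.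

Lemma td_set_connected A : 1 < #|A| -> #|components A| = 1 ->
  (exists2 v, v \in A & td_set A = (td_set (A :\ v)).+1) /\
  (forall v, v \in A -> td_set A <= (td_set (A :\ v)).+1).
Proof.
move=> A1 c1; have A0 : A != set0 by rewrite -card_gt0 ltnW.
rewrite td_set_rec // gtn_eqF // c1 eqxx; split=> [|v vA]; last first.
  by rewrite ltnS bigmin_le.
have [v vA] := set0Pn _ A0.
have le : td_set (A :\ v) <= #|A|.
  by apply: leq_trans (td_set_le _) (subset_leq_card (subsetDl _ _)).
have [u uA ->] := bigmin_attained (F := fun v => td_set (A :\ v)) vA le.
by exists u.
Qed.

Lemma td_set_components A : #|components A| != 1 ->
  td_set A = \max_(B in components A) td_set B.
Proof.
have [->|A0] := eqVneq A set0; first by rewrite components_set0 td_set0 big_set0.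
move=> n1; rewrite td_set_rec //; case: eqP => [|_]; last by rewrite (negPf n1).
move/eqP/cards1P => [x eA]; case/negP: n1.
by rewrite eA /components /equivalence_partition imset_set1 cards1.
Qed.

End TreeDepth.

Definition td (C : eqType) (G : cgraph C) : nat := td_set [set: G].

Inductive quantifier := QForall | QExists | QAtLeast of nat.

(* The variable y_i is represented by the number i. *)
Inductive formula (C : Type) :=
| FEq of nat & nat
| FEdge of nat & nat
| FColor of C & nat
| FNot of formula C
| FAnd of formula C & formula C
| FOr of formula C & formula C
| FImp of formula C & formula C
| FIff of formula C & formula C
| FQuant of quantifier & nat & formula C.

Arguments FEq {C}.
Arguments FEdge {C}.

Section Syntax.
Variable C : Type.
Implicit Types phi psi chi : formula C.

Fixpoint free_vars phi : seq nat :=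
  match phi with
  | FEq x y | FEdge x y => [:: x; y]
  | FColor _ x => [:: x]
  | FNot psi => free_vars psi
  | FAnd psi chi | FOr psi chi | FImp psi chi | FIff psi chi =>
      free_vars psi ++ free_vars chi
  | FQuant _ x psi => [seq y <- free_vars psi | y != x]
  end.

Fixpoint bound_vars phi : seq nat :=
  match phi with
  | FEq _ _ | FEdge _ _ | FColor _ _ => [::]
  | FNot psi => bound_vars psi
  | FAnd psi chi | FOr psi chi | FImp psi chi | FIff psi chi =>
      bound_vars psi ++ bound_vars chi
  | FQuant _ x psi => x :: bound_vars psi
  end.

Fixpoint subformula (theta phi : formula C) : Prop :=
  theta = phi \/
  match phi with
  | FEq _ _ | FEdge _ _ | FColor _ _ => False
  | FNot psi | FQuant _ _ psi => subformula theta psi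
  | FAnd psi chi | FOr psi chi | FImp psi chi | FIff psi chi =>
      subformula theta psi \/ subformula theta chi
  end.

Definition sentence phi : Prop := free_vars phi = [::].

Definition requantified (x : nat) phi : Prop :=
  (x \in free_vars phi /\ x \in bound_vars phi) \/
  exists q psi q' chi,
    subformula (FQuant q x psi) phi /\ subformula (FQuant q' x chi) psi.

Definition C0 (k : nat) phi : Prop :=
  (forall x, x \in free_vars phi ++ bound_vars phi -> 1 <= x <= k) /\
  (forall x, ~ requantified x phi).

End Syntax.

Section Semantics.
Variables (C : eqType) (G : cgraph C).

(* Assignments are partial so that sentences can be evaluated in the graph
   without vertices. *)
Definition assignment := nat -> option G.

Definition update (a : assignment) (x : nat) (v : G) : assignment :=
  fun y => if y == x then Some v else a y.

Fixpoint sat (a : assignment) (phi : formula C) : bool :=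
  match phi with
  | FEq x y =>
      if (a x, a y) is (Some u, Some v) then u == v else false
  | FEdge x y =>
      if (a x, a y) is (Some u, Some v) then edge u v else false
  | FColor c x => if a x is Some u then color u == c else false
  | FNot psi => ~~ sat a psi
  | FAnd psi chi => sat a psi && sat a chi
  | FOr psi chi => sat a psi || sat a chi
  | FImp psi chi => sat a psi ==> sat a chi
  | FIff psi chi => sat a psi == sat a chi
  | FQuant QForall x psi => [forall v, sat (update a x v) psi]
  | FQuant QExists x psi => [exists v, sat (update a x v) psi]
  | FQuant (QAtLeast n) x psi => n <= #|[set v | sat (update a x v) psi]|
  end.

Definition models (phi : formula C) : bool := sat (fun=> None) phi.

End Semantics.

Definition identifies (C : eqType) (L : formula C -> Prop) (G : cgraph C) :
    Prop :=
  forall H : cgraph C, ~ isomorphic G H ->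
  exists phi : formula C,
    [/\ L phi, sentence phi & models G phi (+) models H phi].

(* Main.v *)
(* The rank-k type of a tuple of pebbles is the set of formulas with at most k
   nested quantifiers that it satisfies. Tuples of equal rank-(k+1) types have
   extensions of each rank-k type equally often, so a bijection matches these
   extensions.
   By induction on k, if the pebbles of G and H have equal rank-(k+1) types and
   S is a union of components of G minus the pebbles with td(S) <= k, then S is
   isomorphic, over the pebbles, to a union of components of H minus the
   pebbles.
   For a component X = {x} + S with x and its answer y already pebbled, the
   induction hypothesis applies to S = X - x, and the image of S contains all
   unpebbled neighbours of y because the bijection preserves the degree of x.
   For several components, pebbling a root v of a component B (a vertex with
   td(B - v) < k) yields a component of H isomorphic to B; isomorphic components
   have equally many roots, so counting roots shows that H has at least as many
   components of each isomorphism type as S. *)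

Require Import Defs.
From mathcomp Require Import all_boot perm.
From mathcomp.classical Require Import boolp.
Set Implicit Arguments.
Unset Strict Implicit.
Unset Printing Implicit Defensive.

Lemma fiberwise_injection (I J : finType) (K : eqType) (A : {set I})
    (B : {set J}) (p : I -> K) (q : J -> K) (dflt : I -> J) :
  {in A, forall i, #|[set i' in A | p i' == p i]|
                     <= #|[set j in B | q j == p i]|} ->
  exists2 h : I -> J, {in A &, injective h} &
    {in A, forall i, h i \in B /\ q (h i) = p i}.
Proof.
move=> le_fibers.
pose dom k := enum [set i in A | p i == k].
pose cod k := enum [set j in B | q j == k].
pose h i := nth (dflt i) (cod (p i)) (index i (dom (p i))).
have in_dom i : i \in A -> i \in dom (p i) by rewrite mem_enum inE eqxx andbT.
have lt_cod i : i \in A -> index i (dom (p i)) < size (cod (p i)).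
  move=> iA; rewrite -cardE; apply: leq_trans (le_fibers i iA).
  by rewrite cardE index_mem in_dom.
have hP i : i \in A -> h i \in B /\ q (h i) = p i.
  move=> /lt_cod/(mem_nth (dflt i)); rewrite mem_enum inE.
  by case/andP=> ? /eqP.
exists h => // i i' iA i'A eq_h.
have eq_p : p i = p i' by rewrite -(hP i iA).2 eq_h (hP i' i'A).2.
move: eq_h; rewrite /h eq_p (set_nth_default (dflt i')) -?eq_p ?lt_cod //.
move/eqP; rewrite nth_uniq ?enum_uniq ?lt_cod //; last by rewrite eq_p lt_cod.
by move/eqP; apply: (index_inj i (in_dom i iA)); rewrite eq_p in_dom.
Qed.

Lemma extend_bijection (I J : finType) (A : {set I}) (f : I -> J) :
  #|I| = #|J| -> {in A &, injective f} ->
  exists2 g : I -> J, bijective g & {in A, g =1 f}.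
Proof.
move=> cardIJ injf; pose A' := enum (~: A); pose B' := enum (~: (f @: A)).
pose g i := if i \in A then f i else nth (f i) B' (index i A').
have lt_B' i : i \notin A -> index i A' < size B'.
  move=> iA; have : #|~: A| = #|~: (f @: A)|.
    apply/eqP; rewrite -(eqn_add2l #|A|) cardsC -(card_in_imset injf) cardsC.
    by rewrite cardIJ.
  by rewrite !cardE => <-; rewrite index_mem mem_enum inE.
have gA i : (g i \in f @: A) = (i \in A).
  rewrite /g; case: ifPn => [iA|/lt_B' lt]; first exact: imset_f.
  by have := mem_nth (f i) lt; rewrite mem_enum inE => /negbTE.
exists g => [|i iA]; last by rewrite /g iA.
apply: inj_card_bij; last by rewrite cardIJ.
move=> i i' eq_g; have := gA i; rewrite eq_g gA.
move: eq_g; rewrite /g; case: ifPn => iA; case: ifPn => // i'A; last first.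
  rewrite (set_nth_default (f i')) ?lt_B' // => /eqP.
  rewrite nth_uniq ?lt_B' ?enum_uniq // => /eqP eq_i _.
  by apply: (index_inj i _ _ eq_i); rewrite mem_enum inE.
by move=> /injf->.
Qed.

Lemma imset_setD1 (I J : finType) (f : I -> J) (A : {set I}) x :
  injective f -> f @: (A :\ x) = f @: A :\ f x.
Proof.
move=> injf; apply/setP => y; rewrite in_setD1.
apply/imsetP/andP => [[z + ->]|[ne /imsetP[z zA ey]]].
  by rewrite in_setD1 (inj_eq injf) => /andP[-> zA]; rewrite imset_f.
by exists z; rewrite // in_setD1 zA andbT -(inj_eq injf) -ey.
Qed.

(** * Connected components and tree-depth *)

Section Components.
Variables (C : eqType) (G : cgraph C).
Implicit Types (S T U B : {set G}) (u v x y : G).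

Definition component S x : {set G} := [set y | connect (edge_in S) x y].

Definition saturated U S : Prop := S \subset U /\ closed (edge_in U) S.

Lemma mem_component S x : x \in component S x.
Proof. by rewrite inE connect0. Qed.

Lemma component_eqE S x y :
  (component S y == component S x) = (y \in component S x).
Proof.
apply/eqP/idP => [<-|]; first exact: mem_component.
rewrite inE => xy; apply/setP=> z; rewrite !inE.
by rewrite (same_connect (edge_in_sym S) xy).
Qed.

Lemma component_edge S u v :
  u \in S -> v \in S -> edge u v -> component S u = component S v.
Proof.
move=> uS vS uv; apply/esym/eqP; rewrite component_eqE inE connect1 //.
by rewrite /edge_in /= uS vS.
Qed.

Lemma component_closed S x : closed (edge_in S) (component S x).
Proof. by move=> u v /(connect_closed (edge_in_sym S) x); rewrite !inE. Qed.

Lemma component_min S T x :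
  closed (edge_in S) T -> x \in T -> component S x \subset T.
Proof.
move=> clT xT; apply/subsetP => y.
by rewrite inE => /(closed_connect clT) <-.
Qed.

Lemma component_sub S x : x \in S -> component S x \subset S.
Proof. by apply: component_min => u v /and3P[-> ->]. Qed.

Lemma saturated_component S x : x \in S -> saturated S (component S x).
Proof. by split; [apply: component_sub | apply: component_closed]. Qed.

Lemma component_saturated U S x :
  saturated U S -> x \in S -> component S x = component U x.
Proof.
move=> [SU clS] xS; apply/eqP; rewrite eqEsubset; apply/andP; split.
  apply/subsetP => y; rewrite !inE.
  apply: connect_sub => u v /and3P[/(subsetP SU) uU /(subsetP SU) vU uv].
  by apply: connect1; rewrite /edge_in /= uU vU.
apply: component_min (mem_component _ _).
apply: (intro_closed (@edge_in_sym _ _ U)) => u v euv uC.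
have uS := subsetP (component_sub xS) _ uC.
rewrite -(component_closed x (_ : edge_in S u v)) //.
by case/and3P: (euv) => _ _ uv; rewrite /edge_in /= uS -(clS _ _ euv) uS.
Qed.

Lemma component_id S x :
  x \in S -> component (component S x) x = component S x.
Proof.
by move=> /saturated_component satC; apply/component_saturated/mem_component.
Qed.

Lemma saturated_setD1 U S x : saturated U S -> saturated (U :\ x) (S :\ x).
Proof.
move=> [SU clS]; split=> [|u v]; first exact: setSD.
rewrite /edge_in /= !in_setD1 => /and3P[/andP[-> uU] /andP[-> vU] uv] /=.
by apply: clS; rewrite /edge_in /= uU vU.
Qed.

Lemma saturated_setU1 U S y :
  y \in U -> saturated (U :\ y) S -> {in U, forall z, edge y z -> z \in S} ->
  saturated U (y |: S).
Proof.
move=> yU [/subsetD1P[SU yS] clS] nbrs; split.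
  by rewrite subUset sub1set yU.
apply: (intro_closed (@edge_in_sym _ _ U)) => u v /= /and3P[uU vU uv].
rewrite !in_setU1 => /predU1P uyS; have [//|vy /=] := eqVneq v y.
case: uyS => [uy|uS]; first by rewrite nbrs // -uy.
rewrite -(clS u v) // /edge_in /= !in_setD1 vy uU vU uv.
by rewrite !andbT; apply: contraNneq yS => <-.
Qed.

Lemma componentsE S : components S = [set component S x | x in S].
Proof.
apply: eq_in_imset => x xS; apply/setP => y; rewrite !inE.
apply/andP/idP => [[]//|xy]; split=> //.
by apply: (subsetP (component_sub xS)); rewrite inE.
Qed.

Lemma component_of_mem S B u :
  B \in components S -> u \in B -> u \in S /\ component S u = B.
Proof.
rewrite componentsE => /imsetP[x xS ->] uC.
split; first exact: (subsetP (component_sub xS)).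
by apply/eqP; rewrite component_eqE.
Qed.

Lemma components_component S x :
  x \in S -> components (component S x) = [set component S x].
Proof.
move=> xS; have satC := saturated_component xS; apply/setP => B.
rewrite componentsE inE; apply/imsetP/eqP => [[u uC ->]|->].
  by rewrite (component_saturated satC uC); apply/eqP; rewrite component_eqE.
by exists x; rewrite ?mem_component ?component_id.
Qed.

Lemma card_componentwise S (P : pred {set G}) (R : {set G} -> {set G}) :
  (forall B, R B \subset B) ->
  #|[set u in S | P (component S u) & u \in R (component S u)]|
    = \sum_(B in components S | P B) #|R B|.
Proof.
move=> RB; rewrite -sum1_card.
rewrite (partition_big (component S) [pred B in components S | P B]) /=.
  apply: eq_bigr => B /andP[BS PB]; rewrite -sum1_card; apply: eq_bigl => u.
  rewrite inE; apply/andP/idP => [[/and3P[_ _ uR] /eqP <-] //|uR].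
  have [-> ->] := component_of_mem BS (subsetP (RB B) u uR).
  by rewrite PB uR.
by move=> u; rewrite inE componentsE => /and3P[uS -> _]; rewrite imset_f.
Qed.

Lemma td_set_bigmax_components S :
  td_set S = \max_(B in components S) td_set B.
Proof.
have [/eqP/cards1P[B eB]|] := eqVneq #|components S| 1; last first.
  exact: td_set_components.
have /eqP := cover_partition (components_partition S).
by rewrite /cover eB !big_set1 => /eqP ->.
Qed.

Lemma td_set_component S x (B := component S x) : x \in S ->
  (exists2 v, v \in B & td_set B = (td_set (B :\ v)).+1) /\
  {in B, forall v, td_set B <= (td_set (B :\ v)).+1}.
Proof.
move=> xS; have xB : x \in B by apply: mem_component.
have [cardB|] := ltnP 1 #|B|.
  by apply: td_set_connected; rewrite // components_component ?cards1.
have B_gt0 : 0 < #|B| by apply/card_gt0P; exists x.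
rewrite leq_eqVlt ltnNge B_gt0 orbF => /cards1P[v ->].
rewrite td_set_card1 ?cards1 //; split=> [|//].
by exists v; rewrite ?set11 // setDv td_set0.
Qed.

Lemma td_set_eq0 S : (td_set S == 0) = (S == set0).
Proof.
apply/idP/eqP => [|->]; last by rewrite td_set0.
apply: contraTeq => /set0Pn[x xS]; rewrite -lt0n td_set_bigmax_components.
have [[v _ tdB] _] := td_set_component xS.
apply: leq_trans (leq_bigmax_cond (component S x) _); first by rewrite tdB.
by rewrite componentsE imset_f.
Qed.

Lemma td_set_leS k S :
  td_set S <= k.+1 <-> {in S, forall x, exists2 v, v \in component S x &
                                   td_set (component S x :\ v) <= k}.
Proof.
rewrite td_set_bigmax_components; split=> [/bigmax_leqP tdS x xS|tdS].
  have [[v vB tdB] _] := td_set_component xS.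
  by exists v; rewrite // -ltnS -tdB tdS // componentsE imset_f.
apply/bigmax_leqP => B; rewrite componentsE => /imsetP[x xS ->].
have [v vB tdB] := tdS _ xS; have [_ tdB_le] := td_set_component xS.
exact: leq_trans (tdB_le v vB) _.
Qed.

End Components.

Section EdgePreserving.
Variables (C : eqType) (G H : cgraph C) (f : G -> H).

Definition edge_preserving (S : {set G}) : Prop :=
  {in S &, forall u v, edge (f u) (f v) = edge u v}.

Lemma edge_preserving_sub (S T : {set G}) :
  T \subset S -> edge_preserving S -> edge_preserving T.
Proof. by move=> /subsetP TS; apply: sub_in2. Qed.

Hypothesis injf : injective f.

Lemma component_image (S : {set G}) u :
  edge_preserving S -> u \in S ->
  component (f @: S) (f u) = f @: component S u.
Proof.
move=> edgef uS; have /subsetP CS := component_sub uS.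
apply/eqP; rewrite eqEsubset; apply/andP; split.
  apply: component_min; last by rewrite imset_f ?mem_component.
  apply: (intro_closed (@edge_in_sym _ _ (f @: S))) => w w' ww /imsetP[x xC ew].
  have [_ /imsetP[y yS ->]] := and3P ww; rewrite {}ew in ww *.
  rewrite (edgef _ _ (CS x xC) yS) => xy; apply: imset_f.
  by rewrite -component_eqE -(component_edge (CS x xC) yS xy) component_eqE.
apply/subsetP => _ /imsetP[v vC ->].
suff /subsetP/(_ v vC) : component S u \subset f @^-1: component (f @: S) (f u).
  by rewrite inE.
apply: component_min; last by rewrite inE mem_component.
move=> x y /and3P[xS yS xy].
rewrite !inE; apply: (same_connect1r (edge_in_sym _)).
by rewrite /edge_in /= !imset_f ?edgef.
Qed.

Lemma td_set_image_le k (S : {set G}) :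
  edge_preserving S -> td_set S <= k -> td_set (f @: S) <= k.
Proof.
elim: k S => [|k IH] S edgef.
  by rewrite !leqn0 !td_set_eq0 => /eqP ->; rewrite imset0.
move=> /td_set_leS tdS; apply/td_set_leS => _ /imsetP[u uS ->].
have [v vC tdv] := tdS u uS.
rewrite component_image //; exists (f v); first exact: imset_f.
rewrite -imset_setD1 //; apply: IH tdv.
apply: edge_preserving_sub edgef.
by rewrite (subset_trans (subsetDl _ _)) ?component_sub.
Qed.

End EdgePreserving.

Section GlueComponents.
Variables (C : eqType) (G H : cgraph C) (S : {set G}) (T : {set H}).
Variables (f : G -> H) (h : {set G} -> {set H}).
Hypothesis injh : {in components S &, injective h}.
Hypothesis hT : {in components S, forall B : {set G}, h B \in components T}.
Hypothesis imf : {in components S, forall B : {set G}, f @: B = h B}.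

Let compS u : u \in S -> component S u \in components S.
Proof. by move=> uS; rewrite componentsE imset_f. Qed.

Let f_component u : u \in S ->
  f u \in T /\ component T (f u) = h (component S u).
Proof.
move=> /compS CS; apply: component_of_mem (hT CS) _.
by rewrite -imf // imset_f ?mem_component.
Qed.

Let component_f_inj u v : u \in S -> v \in S ->
  component T (f u) = component T (f v) -> component S u = component S v.
Proof.
move=> uS vS; rewrite (f_component uS).2 (f_component vS).2.
exact: injh (compS uS) (compS vS).
Qed.

Lemma glue_injective :
  {in components S, forall B : {set G}, {in B &, injective f}} ->
  {in S &, injective f}.
Proof.
move=> injfB u v uS vS eq_f.
have eqC : component S u = component S v.
  by apply: component_f_inj; rewrite ?eq_f.
apply: (injfB _ (compS uS)) eq_f; rewrite ?mem_component //.
by rewrite eqC mem_component.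
Qed.

Lemma glue_edge_preserving :
  {in components S, forall B : {set G}, edge_preserving f B} ->
  edge_preserving f S.
Proof.
move=> edgefB u v uS vS.
have [eqC|neC] := eqVneq (component S u) (component S v).
  by rewrite (edgefB _ (compS uS)) ?mem_component // eqC mem_component.
have [fuT _] := f_component uS; have [fvT _] := f_component vS.
apply/idP/idP=> uv; case/eqP: neC; last exact: component_edge.
exact: component_f_inj (component_edge fuT fvT uv).
Qed.

Lemma glue_saturated : saturated T (f @: S).
Proof.
split; first by apply/subsetP => _ /imsetP[u /f_component[fuT _] ->].
apply: (intro_closed (@edge_in_sym _ _ T)) => w w' /and3P[wT w'T ww'].
case/imsetP=> u uS ew; have CS := compS uS.
have : w' \in h (component S u).
  rewrite -(f_component uS).2 -ew -component_eqE.
  by rewrite (component_edge wT w'T ww') eqxx.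
rewrite -(imf CS) => /imsetP[v vC ->].
by rewrite imset_f // (subsetP (component_sub uS)).
Qed.

End GlueComponents.

(** * Formulas without requantification *)

Section Layered.
Variable C : Type.
Implicit Types phi psi : formula C.

(* A quantifier in the scope of [i] others binds y_(r+i+1), so that no variable
   is requantified. *)
Fixpoint layered k r phi : bool :=
  match phi with
  | FEq x y | FEdge x y => (0 < x <= r) && (0 < y <= r)
  | FColor _ x => 0 < x <= r
  | FNot psi => layered k r psi
  | FAnd psi chi | FOr psi chi | FImp psi chi | FIff psi chi =>
      layered k r psi && layered k r chi
  | FQuant _ x psi =>
      if k is k'.+1 then (x == r.+1) && layered k' r.+1 psi else false
  end.

Lemma layered_free k r phi x :
  layered k r phi -> x \in free_vars phi -> 0 < x <= r.
Proof.
elim: phi k r => //= [y z|y z|c y|f IHf g IHg|f IHf g IHg|f IHf g IHg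
    |f IHf g IHg|q y psi IH] k r.
1-2: by move=> /andP[? ?]; rewrite !inE => /orP[] /eqP ->.
- by move=> ?; rewrite inE => /eqP ->.
1-4: by move=> /andP[lf lg]; rewrite mem_cat => /orP[/(IHf k)|/(IHg k)]; apply.
case: k => // k /andP[/eqP -> l]; rewrite mem_filter => /andP[ne /(IH _ _ l)].
by rewrite (leq_eqVlt x) (negPf ne).
Qed.

Lemma layered_bound k r phi x :
  layered k r phi -> x \in bound_vars phi -> r < x <= r + k.
Proof.
elim: phi k r => //= [f IHf g IHg|f IHf g IHg|f IHf g IHg|f IHf g IHg
    |q y psi IH] k r.
1-4: by move=> /andP[lf lg]; rewrite mem_cat => /orP[/(IHf k)|/(IHg k)]; apply.
case: k => // k /andP[/eqP -> l]; rewrite inE addnS => /predU1P[->|/(IH _ _ l)].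
  by rewrite ltnSn ltnS leq_addr.
by rewrite addSn => /andP[/ltnW -> ->].
Qed.

Lemma layered_subformula k r phi q x psi :
  layered k r phi -> subformula (FQuant q x psi) phi ->
  r < x /\ exists k', layered k' x psi.
Proof.
elim: phi k r => [y z|y z|c y|chi IH|f IHf g IHg|f IHf g IHg|f IHf g IHg
    |f IHf g IHg|q' y chi IH] k r /=.
1-3: by move=> _ [].
- by move=> l [//|]; apply: IH l.
1-4: by move=> /andP[lf lg] [//|[]]; [apply: IHf lf | apply: IHg lg].
case: k => // k /andP[/eqP -> l] [[_ -> ->]|]; first by split=> //; exists k.
by case/(IH _ _ l) => /ltnW.
Qed.

Lemma layered_sentence k phi : layered k 0 phi -> sentence phi.
Proof.
rewrite /sentence => l; case E: (free_vars phi) => [//|x s].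
have := layered_free l (_ : x \in free_vars phi).
by rewrite E mem_head => /(_ isT); case: x {E}.
Qed.

Lemma layered_C0 k r phi : layered k r phi -> C0 (r + k) phi.
Proof.
move=> l; split=> x.
  rewrite mem_cat => /orP[/(layered_free l)|/(layered_bound l)] /andP[lt le].
    by rewrite lt (leq_trans le) ?leq_addr.
  by rewrite le (leq_trans _ lt).
case=> [[/(layered_free l)/andP[_ le] /(layered_bound l)/andP[]]|].
  by rewrite ltnNge le.
case=> [q [psi [q' [chi [s s']]]]].
have [_ [k' lx]] := layered_subformula l s.
by have [] := layered_subformula lx s'; rewrite ltnn.
Qed.

End Layered.

(** * Rank-k types of pebbled graphs *)

Section RankTypes.
Variable C : eqType.
Implicit Types (G H K L : cgraph C) (phi psi : formula C).

(* The i-th pebble, counted from 0, interprets the variable y_(i+1). *)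
Definition asg G (a : seq G) : assignment G :=
  nth None (None :: [seq Some u | u <- a]).

Lemma asg_nil G : asg ([::] : seq G) = fun=> None.
Proof. by apply: funext => -[|i] //=; rewrite /asg /= nth_nil. Qed.

Lemma update_asg G (a : seq G) v :
  update (asg a) (size a).+1 v = asg (rcons a v).
Proof.
apply: funext => -[|i] //; rewrite /update /asg /= eqSS map_rcons nth_rcons.
rewrite size_map; case: ltngtP => // lt.
by rewrite nth_default // size_map ltnW.
Qed.

Lemma asg_nth G (x : G) (a : seq G) i :
  i < size a -> asg a i.+1 = Some (nth x a i).
Proof. by move=> lt; rewrite /asg /= (nth_map x). Qed.

Lemma asg_rcons_last G (a : seq G) v : asg (rcons a v) (size a).+1 = Some v.
Proof. by rewrite (asg_nth v) ?size_rcons // nth_rcons ltnn eqxx. Qed.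

Definition rank_type G k (a : seq G) : {classic formula C -> bool} :=
  fun phi => layered k (size a) phi && sat (asg a) phi.

Lemma rank_type_size G H k (a : seq G) (b : seq H) :
  rank_type k a = rank_type k b -> size a = size b.
Proof.
have size_le K L (c : seq K) (d : seq L) :
    rank_type k c = rank_type k d -> size c <= size d.
  case: c => [|x c] // eq_type.
  have := congr1 (@^~ (FEq (size c).+1 (size c).+1)) eq_type.
  by rewrite /rank_type /= (asg_nth x) //= eqxx !ltnSn => /esym/andP[/andP[]].
by move=> eq_type; apply/eqP; rewrite eqn_leq !size_le.
Qed.

Lemma rank_type_sat G H k (a : seq G) (b : seq H) phi :
  rank_type k a = rank_type k b -> layered k (size a) phi ->
  sat (asg a) phi = sat (asg b) phi.
Proof.
move=> eq_type l; have := congr1 (@^~ phi) eq_type.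
by rewrite /rank_type -(rank_type_size eq_type) l.
Qed.

Lemma rank_type_separation G H k (a : seq G) (b : seq H) :
  size a = size b -> rank_type k a <> rank_type k b ->
  exists phi, [/\ layered k (size a) phi, sat (asg a) phi & ~~ sat (asg b) phi].
Proof.
move=> eq_size ne_type.
have /existsNP[phi] : ~ forall phi, rank_type k a phi = rank_type k b phi.
  by move=> eq_type; apply: ne_type; apply: funext.
rewrite /rank_type -eq_size; case l: layered => //=.
case sa: (sat (asg a) phi); case sb: (sat (asg b) phi) => // _.
  by exists phi; rewrite sa sb.
by exists (FNot phi); rewrite /= sa sb.
Qed.

Lemma exists_isolating_formula G H k (a : seq G) (J : finType)
    (c : J -> seq H) :
  0 < size a -> (forall j, size (c j) = size a) ->
  exists phi, [/\ layered k (size a) phi, sat (asg a) phi &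
    forall j, sat (asg (c j)) phi -> rank_type k (c j) = rank_type k a].
Proof.
move=> size_gt0 size_c.
(* There is no constant for truth, and [FEq 1 1] requires a pebble. *)
have truth : layered k (size a) (FEq 1 1 : formula C) /\ sat (asg a) (FEq 1 1).
  by case: (a) size_gt0 => //= x s _; rewrite /asg /= eqxx.
have /fin_all_exists[psi psiP] j : exists psi,
    [/\ layered k (size a) psi, sat (asg a) psi &
      sat (asg (c j)) psi -> rank_type k (c j) = rank_type k a].
  have [eq_type|/eqP ne] := eqVneq (rank_type k (c j)) (rank_type k a).
    by exists (FEq 1 1); case: truth.
  have [phi [l s ns]] := rank_type_separation (esym (size_c j)) (nesym ne).
  by exists phi; split=> //; rewrite (negPf ns).
pose big_and := foldr (fun j => FAnd (psi j)) (FEq 1 1).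
exists (big_and (enum J)).
have big_andP r : [/\ layered k (size a) (big_and r), sat (asg a) (big_and r) &
    forall j, j \in r -> sat (asg (c j)) (big_and r) ->
      rank_type k (c j) = rank_type k a].
  elim: r => [|i r [l s IH]] /=; first by case: truth.
  have [li si isol] := psiP i; split=> [||j]; rewrite ?li ?si //.
  rewrite inE => /predU1P[->|jr] /andP[]; first by move=> /isol.
  by move=> _; apply: IH.
have [l s isol] := big_andP (enum J); split=> // j; apply: isol.
by rewrite mem_enum.
Qed.

Lemma card_rank_type_le G H k (a : seq G) (b : seq H) v :
  rank_type k.+1 a = rank_type k.+1 b ->
  #|[set v' | rank_type k (rcons a v') == rank_type k (rcons a v)]|
    <= #|[set w | rank_type k (rcons b w) == rank_type k (rcons a v)]|.
Proof.
move=> eq_type; have eq_size := rank_type_size eq_type.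
have [||phi [l s isol]] :=
    @exists_isolating_formula G H k (rcons a v) H (rcons b).
1-2: by rewrite ?size_rcons // => w; rewrite !size_rcons eq_size.
rewrite size_rcons in l.
pose T := [set v' | rank_type k (rcons a v') == rank_type k (rcons a v)].
pose theta := FQuant (QAtLeast #|T|) (size a).+1 phi.
have theta_layered : layered k.+1 (size a) theta by rewrite /= eqxx l.
have theta_a : sat (asg a) theta.
  suff : T \subset [set v' | sat (update (asg a) (size a).+1 v') phi].
    exact: subset_leq_card.
  apply/subsetP => v'; rewrite !inE update_asg => /eqP ev.
  by rewrite (rank_type_sat ev) ?size_rcons.
rewrite (rank_type_sat eq_type theta_layered) /= in theta_a.
apply: leq_trans theta_a _; apply: subset_leq_card; apply/subsetP => w.
by rewrite !inE eq_size update_asg => /isol ->.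
Qed.

(* Duplicator's answer in the bijective pebble game. *)
Lemma rank_type_bijection G H k (a : seq G) (b : seq H) :
  rank_type k.+1 a = rank_type k.+1 b ->
  exists2 f : G -> H, bijective f &
    forall v, rank_type k (rcons b (f v)) = rank_type k (rcons a v).
Proof.
have injection K L (c : seq K) (d : seq L) :
    rank_type k.+1 c = rank_type k.+1 d ->
    exists2 f : K -> L, injective f &
      forall v, rank_type k (rcons d (f v)) = rank_type k (rcons c v).
  move=> eq_type; have /fin_all_exists[dflt _] (v : K) : exists w : L, true.
    have /card_gt0P[w _] : 0 < #|[set w |
        rank_type k (rcons d w) == rank_type k (rcons c v)]|.
      apply: leq_trans (card_rank_type_le v eq_type).
      by apply/card_gt0P; exists v; rewrite inE.
    by exists w.
  have [|f injf fP] := @fiberwise_injection _ _ _ [set: K] [set: L]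
      (fun v => rank_type k (rcons c v)) (fun w => rank_type k (rcons d w))
      dflt.
    move=> v _; have := card_rank_type_le v eq_type.
    by congr (_ <= _); apply: eq_card => x; rewrite !inE.
  exists f => [x y|v]; first by apply: injf; rewrite inE.
  by have [] := fP v (in_setT v).
move=> eq_type; have [f injf fP] := injection _ _ _ _ eq_type.
have [g injg _] := injection _ _ _ _ (esym eq_type).
by exists f => //; apply: inj_card_bij injf (leq_card g injg).
Qed.

(* The isomorphism type, over the pebbles, of an unpebbled vertex. *)
Definition profile G (a : seq G) u : C * seq bool :=
  (color u, [seq edge x u | x <- a]).

Lemma profile_rcons G H (a : seq G) (b : seq H) x y u w :
  profile (rcons a x) u = profile (rcons b y) w <->
  profile a u = profile b w /\ edge x u = edge y w.
Proof.
by rewrite /profile !map_rcons; split=> [[-> /rcons_inj[-> ->]]|[[-> ->] ->]].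
Qed.

Section LastPebble.
Variables (G H : cgraph C) (k : nat) (a : seq G) (b : seq H) (v : G) (w : H).
Hypothesis eq_type : rank_type k (rcons a v) = rank_type k (rcons b w).

Let eq_size : size a = size b.
Proof. by have := rank_type_size eq_type; rewrite !size_rcons => -[]. Qed.

Lemma rank_type_color : color v = color w.
Proof.
have := rank_type_sat (phi := FColor (color v) (size a).+1) eq_type.
rewrite /= asg_rcons_last eq_size asg_rcons_last eqxx size_rcons eq_size.
by rewrite ltnSn => /(_ isT)/esym/eqP ->.
Qed.

Lemma rank_type_atom (atom : nat -> nat -> formula C)
    (r : forall K : cgraph C, rel K) :
  (forall n i j, layered k n (atom i j) = (0 < i <= n) && (0 < j <= n)) ->
  (forall K (e : assignment K) i j, sat e (atom i j) =
     if (e i, e j) is (Some x, Some y) then r K x y else false) ->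
  [seq r G x v | x <- a] = [seq r H y w | y <- b].
Proof.
move=> layered_atom sat_atom.
have atomE K (c : seq K) z i : i < size c ->
    sat (asg (rcons c z)) (atom i.+1 (size c).+1)
      = nth false [seq r K x z | x <- c] i.
  move=> lt; have lt' : i < size (rcons c z) by rewrite size_rcons ltnW.
  rewrite sat_atom (asg_nth z lt') (asg_rcons_last c z) nth_rcons lt.
  by rewrite (nth_map z).
apply: (@eq_from_nth _ false) => [|i]; rewrite !size_map ?eq_size // => lt.
rewrite -!atomE ?eq_size // (rank_type_sat eq_type) //.
by rewrite layered_atom size_rcons eq_size !ltnS (ltnW lt) leqnn.
Qed.

Lemma rank_type_profile : profile a v = profile b w.
Proof.
rewrite /profile rank_type_color; congr pair.
exact: (@rank_type_atom FEdge (fun K => @edge C K)).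
Qed.

Lemma rank_type_mem : (v \in a) = (w \in b).
Proof.
have memE K (c : seq K) z : (z \in c) = (true \in [seq x == z | x <- c]).
  by apply/idP/mapP => [zc|[x xc /esym/eqP <-]//]; exists z; rewrite ?eqxx.
rewrite !memE.
by rewrite (@rank_type_atom FEq (fun K => @eq_op K)).
Qed.

End LastPebble.
End RankTypes.

(** * Isomorphisms over the pebbles *)

Section PebbledIso.
Variable C : eqType.
Implicit Types (G H K : cgraph C).

(* Only the restriction of [f] to [S] matters; it is total and bijective so that
   images, inverses and composites need no default values. *)
Definition pebbled_iso G H (a : seq G) (b : seq H) (f : G -> H)
    (S : {set G}) : Prop :=
  [/\ bijective f, edge_preserving f S &
      {in S, forall u, profile b (f u) = profile a u}].

Lemma pebbled_iso_id G (a : seq G) S : pebbled_iso a a id S.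
Proof. by split=> //; exists id. Qed.

Lemma pebbled_iso_inv G H (a : seq G) (b : seq H) f g S :
  cancel f g -> cancel g f -> pebbled_iso a b f S ->
  pebbled_iso b a g (f @: S).
Proof.
move=> fK gK [_ edgef proff]; split; first by exists f.
  by move=> _ _ /imsetP[u uS ->] /imsetP[v vS ->]; rewrite !fK edgef.
by move=> _ /imsetP[u uS ->]; rewrite fK proff.
Qed.

Lemma pebbled_iso_comp G H K (a : seq G) (b : seq H) (c : seq K) f g S :
  pebbled_iso a b f S -> pebbled_iso b c g (f @: S) ->
  pebbled_iso a c (g \o f) S.
Proof.
move=> [bijf edgef proff] [bijg edgeg profg]; split; first exact: bij_comp.
  by move=> u v uS vS; rewrite /= edgeg ?imset_f ?edgef.
by move=> u uS; rewrite /= profg ?imset_f ?proff.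
Qed.

Lemma pebbled_iso_add_root G H (a : seq G) (b : seq H) f S x y :
  pebbled_iso (rcons a x) (rcons b y) f S -> x \notin S -> y \notin f @: S ->
  profile a x = profile b y ->
  exists g, [/\ pebbled_iso a b g (x |: S), g x = y & {in S, g =1 f}].
Proof.
move=> [bijf edgef proff] xS yS profxy; have injf := bij_inj bijf.
pose g := tperm (f x) y \o f.
have gx : g x = y by rewrite /g /= tpermL.
have gS : {in S, g =1 f}.
  move=> u uS; rewrite /g /= tpermD //; last first.
    by apply: contraNneq yS => ->; apply: imset_f.
  by rewrite (inj_eq injf); apply: contraNneq xS => ->.
have prof_edge u : u \in S ->
    profile b (f u) = profile a u /\ edge y (f u) = edge x u.
  by move=> /proff/profile_rcons.
exists g; split=> //; split.
- exact: bij_comp (injF_bij perm_inj) bijf.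
- move=> u v; rewrite !in_setU1 => /predU1P[->|uS] /predU1P[->|vS].
  + by rewrite !edge_irr.
  + by rewrite gx gS // (prof_edge v vS).2.
  + by rewrite gx gS // edge_sym (prof_edge u uS).2 edge_sym.
  + by rewrite !gS // edgef.
- move=> u; rewrite !in_setU1 => /predU1P[->|uS]; first by rewrite gx.
  by rewrite gS // (prof_edge u uS).1.
Qed.

Definition isomorphic_over G H (a : seq G) (b : seq H) S D : bool :=
  `[< exists2 f, pebbled_iso a b f S & f @: S = D >].

Lemma isomorphic_over_refl G (a : seq G) S : isomorphic_over a a S S.
Proof.
by apply/asboolP; exists id; [apply: pebbled_iso_id | rewrite imset_id].
Qed.

Lemma isomorphic_over_sym G H (a : seq G) (b : seq H) S D :
  isomorphic_over a b S D -> isomorphic_over b a D S.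
Proof.
case/asboolP=> f isof <-; have [[g fK gK] _ _] := isof.
apply/asboolP; exists g; first exact: (pebbled_iso_inv fK gK).
by rewrite -imset_comp (eq_imset _ fK) imset_id.
Qed.

Lemma isomorphic_over_trans G H K (a : seq G) (b : seq H) (c : seq K) S D E :
  isomorphic_over a b S D -> isomorphic_over b c D E -> isomorphic_over a c S E.
Proof.
case/asboolP=> f isof <- /asboolP[g isog <-]; apply/asboolP.
by exists (g \o f); [apply: pebbled_iso_comp isof isog | rewrite imset_comp].
Qed.

(* The reference position (H, b) makes isomorphism types over different graphs
   comparable. *)
Definition iso_type H (b : seq H) G (a : seq G) (S : {set G}) : {set {set H}} :=
  [set D | isomorphic_over a b S D].

Lemma iso_typeP H (b : seq H) G (a : seq G) S D :
  reflect (iso_type b a S = iso_type b b D) (isomorphic_over a b S D).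
Proof.
apply: (iffP idP) => [SD|eq_type].
  apply/setP => E; rewrite !inE.
  apply/idP/idP; apply: isomorphic_over_trans => //.
  exact: isomorphic_over_sym.
have : D \in iso_type b b D by rewrite inE isomorphic_over_refl.
by rewrite -eq_type inE.
Qed.

Definition td_roots G k (S : {set G}) : {set G} :=
  [set v in S | td_set (S :\ v) <= k].

Lemma td_roots_sub G k (S : {set G}) : td_roots k S \subset S.
Proof. by apply/subsetP => v; rewrite inE => /andP[]. Qed.

Lemma td_roots_image G H (a : seq G) (b : seq H) f k S v :
  pebbled_iso a b f S -> v \in td_roots k S -> f v \in td_roots k (f @: S).
Proof.
move=> [bijf edgef _]; have injf := bij_inj bijf.
rewrite !inE => /andP[vS tdv]; rewrite imset_f // -imset_setD1 //.
exact/(td_set_image_le injf _ tdv)/(edge_preserving_sub _ edgef)/subsetDl.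
Qed.

Lemma card_td_roots G H (a : seq G) (b : seq H) k S D :
  isomorphic_over a b S D -> #|td_roots k S| = #|td_roots k D|.
Proof.
have card_le (K L : cgraph C) (c : seq K) (d : seq L) B E :
    isomorphic_over c d B E -> #|td_roots k B| <= #|td_roots k E|.
  case/asboolP=> f isof <-; have [/bij_inj injf _ _] := isof.
  rewrite -(card_imset _ injf); apply: subset_leq_card.
  by apply/subsetP => _ /imsetP[v vB ->]; apply: td_roots_image isof vB.
move=> iso; apply/eqP; rewrite eqn_leq (card_le _ _ _ _ _ _ iso).
exact: card_le (isomorphic_over_sym iso).
Qed.

End PebbledIso.

(** * From equal types to isomorphisms *)

Section Unpebbled.
Variables (C : eqType) (G : cgraph C).
Implicit Type a : seq G.

Definition unpebbled a : {set G} := [set u | u \notin a].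

Lemma unpebbled_rcons a x : unpebbled (rcons a x) = unpebbled a :\ x.
Proof. by apply/setP => u; rewrite !inE mem_rcons inE negb_or. Qed.

Definition free_neighbours a x : {set G} :=
  [set z in unpebbled (rcons a x) | edge x z].

End Unpebbled.

Lemma rank_type_unpebbled (C : eqType) (G H : cgraph C) k (a : seq G)
    (b : seq H) v w :
  rank_type k (rcons a v) = rank_type k (rcons b w) ->
  (v \in unpebbled a) = (w \in unpebbled b).
Proof. by move=> eq_type; rewrite !inE (rank_type_mem eq_type). Qed.

Lemma card_free_neighbours (C : eqType) (G H : cgraph C) k (a : seq G)
    (b : seq H) x y :
  rank_type k.+1 (rcons a x) = rank_type k.+1 (rcons b y) ->
  #|free_neighbours a x| = #|free_neighbours b y|.
Proof.
move=> eq_type; have [f bijf fP] := rank_type_bijection eq_type.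
have injf := bij_inj bijf; have [g _ gK] := bijf.
rewrite -(card_imset _ injf); congr #|pred_of_set _|; apply/setP => w.
rewrite -(gK w) mem_imset //; have eg := fP (g w).
have /profile_rcons[_ edge_g] := rank_type_profile eg.
by rewrite !inE (rank_type_mem eg) edge_g.
Qed.

Section Transfer.
Variables (C : eqType) (G H : cgraph C).
Implicit Types (a : seq G) (b : seq H) (S : {set G}).

Definition transfer k : Prop := forall a b S,
  rank_type k.+1 a = rank_type k.+1 b ->
  saturated (unpebbled a) S -> td_set S <= k ->
  exists2 f, pebbled_iso a b f S & saturated (unpebbled b) (f @: S).

Definition rooted_transfer k : Prop := forall a b x y,
  rank_type k.+1 (rcons a x) = rank_type k.+1 (rcons b y) ->
  x \in unpebbled a -> td_set (component (unpebbled a) x :\ x) <= k ->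
  exists f, [/\ pebbled_iso a b f (component (unpebbled a) x), f x = y &
    f @: component (unpebbled a) x = component (unpebbled b) y].

(* Equal types force [x] and [y] to have equally many free neighbours, so those
   matched by [f] are all of them. *)
Lemma free_neighbours_sub_image k a b x y f S :
  rank_type k.+1 (rcons a x) = rank_type k.+1 (rcons b y) ->
  pebbled_iso (rcons a x) (rcons b y) f S ->
  f @: S \subset unpebbled (rcons b y) -> free_neighbours a x \subset S ->
  free_neighbours b y \subset f @: S.
Proof.
move=> eq_type [bijf edgef proff] fS NS.
suff /eqP <- : f @: free_neighbours a x == free_neighbours b y by apply: imsetS.
rewrite eqEcard (card_imset _ (bij_inj bijf)) (card_free_neighbours eq_type).
rewrite leqnn andbT.
apply/subsetP => _ /imsetP[z zN ->]; have zS := subsetP NS z zN.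
have /profile_rcons[_ edge_z] := proff z zS.
rewrite in_set (subsetP fS) ?imset_f // edge_z.
by move: zN; rewrite in_set => /andP[].
Qed.

Lemma free_neighbours_component a x :
  x \in unpebbled a ->
  free_neighbours a x \subset component (unpebbled a) x :\ x.
Proof.
move=> xU; apply/subsetP => z; rewrite in_set unpebbled_rcons in_setD1.
case/andP=> /andP[zx zU] xz; rewrite in_setD1 zx -component_eqE.
by rewrite (component_edge xU zU xz) eqxx.
Qed.

Lemma transfer_rooted k : transfer k -> rooted_transfer k.
Proof.
move=> transfer_k a b x y eq_type xU tdX.
have xX := mem_component (unpebbled a) x; set X := component _ x in xX tdX *.
have satX : saturated (unpebbled a) X by apply: saturated_component.
have satS : saturated (unpebbled (rcons a x)) (X :\ x).
  by rewrite unpebbled_rcons; apply: saturated_setD1.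
have [f isof satD] := transfer_k _ _ _ eq_type satS tdX.
have nbrs :=
  free_neighbours_sub_image eq_type isof satD.1 (free_neighbours_component xU).
rewrite unpebbled_rcons in satD.
have yU : y \in unpebbled b by rewrite -(rank_type_unpebbled eq_type).
have yD : y \notin f @: (X :\ x) by have [/subsetD1P[]] := satD.
have profxy := rank_type_profile eq_type.
have [|g [isog gx gS]] := pebbled_iso_add_root isof _ yD profxy.
  by rewrite in_setD1 eqxx.
rewrite setD1K // in isog.
have gX : g @: X = y |: f @: (X :\ x).
  by rewrite -{1}(setD1K xX) imsetU1 gx (eq_in_imset gS).
have satY : saturated (unpebbled b) (g @: X).
  rewrite gX; apply: saturated_setU1 => // z zU yz; apply: (subsetP nbrs).
  rewrite in_set yz unpebbled_rcons in_setD1 zU !andbT.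
  by apply: contraTneq yz => ->; rewrite edge_irr.
exists g; split=> //; have [bijg edgeg _] := isog.
rewrite -[in RHS]gx -(component_saturated satY (imset_f g xX)).
by rewrite component_image ?bij_inj // component_id.
Qed.

Section TypedRoots.
Variables (k : nat) (b : seq H) (D : {set H}).

Definition typed_roots (K : cgraph C) (c : seq K) (S : {set K}) : {set K} :=
  [set u in S | iso_type b c (component S u) == iso_type b b D
              & u \in td_roots k (component S u)].

Lemma card_typed_roots (K : cgraph C) (c : seq K) (S : {set K}) :
  #|typed_roots c S| =
    #|[set B in components S | iso_type b c B == iso_type b b D]|
      * #|td_roots k D|.
Proof.
rewrite (card_componentwise _ (fun B => iso_type b c B == _) (td_roots_sub _)).
rewrite -sum_nat_const; apply: eq_big => [B|B]; first by rewrite inE.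
by case/andP=> _ /eqP/iso_typeP; apply: card_td_roots.
Qed.

End TypedRoots.

Lemma typed_roots_image k a b f S D :
  rooted_transfer k ->
  (forall v, rank_type k.+1 (rcons b (f v)) = rank_type k.+1 (rcons a v)) ->
  saturated (unpebbled a) S ->
  f @: typed_roots k b D a S \subset typed_roots k b D b (unpebbled b).
Proof.
move=> rooted fP satS; have [SU _] := satS.
apply/subsetP => _ /imsetP[u + ->]; rewrite in_set => /and3P[uS tuD ru].
have uU := subsetP SU u uS; rewrite (component_saturated satS uS) in tuD ru.
have [|g [isog gu gC]] := rooted _ _ _ _ (esym (fP u)) uU.
  by move: ru; rewrite in_set => /andP[].
rewrite in_set -gC -{2}gu (td_roots_image isog) // andbT.
rewrite (rank_type_unpebbled (fP u)) uU -(eqP tuD).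
apply/eqP/esym/iso_typeP/asboolP.
by exists g.
Qed.

Lemma component_matching k a b S :
  rooted_transfer k -> rank_type k.+2 a = rank_type k.+2 b ->
  saturated (unpebbled a) S -> td_set S <= k.+1 ->
  exists2 h : {set G} -> {set H}, {in components S &, injective h} &
    {in components S, forall B : {set G},
      h B \in components (unpebbled b) /\ isomorphic_over a b B (h B)}.
Proof.
move=> rooted eq_type satS /td_set_leS tdS.
have [f bijf fP] := rank_type_bijection eq_type.
have [|h injh hP] := @fiberwise_injection _ _ _ (components S)
    (components (unpebbled b)) (iso_type b a) (iso_type b b) (fun=> set0).
  move=> B; rewrite componentsE => /imsetP[x xS ->].
  have [v vC tdv] := tdS x xS; have vS := subsetP (component_sub xS) v vC.
  have vU := subsetP satS.1 v vS.
  have eC : component S x = component (unpebbled a) v.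
    rewrite -(component_saturated satS vS); apply/esym/eqP.
    by rewrite component_eqE.
  rewrite eC in vC tdv *.
  have [g [isog _ gC]] := rooted _ _ _ _ (esym (fP v)) vU tdv.
  set D := component (unpebbled b) (f v) in gC.
  have /iso_typeP -> : isomorphic_over a b (component (unpebbled a) v) D.
    by apply/asboolP; exists g.
  have roots_gt0 : 0 < #|td_roots k D|.
    apply/card_gt0P; exists (g v); rewrite -gC; apply: td_roots_image isog _.
    by rewrite in_set vC.
  rewrite -componentsE -(leq_pmul2r roots_gt0) -!card_typed_roots.
  rewrite -(card_imset _ (bij_inj bijf)); apply: subset_leq_card.
  exact: typed_roots_image.
by exists h => // B /hP[? /esym/iso_typeP].
Qed.

Lemma glue_components a b S (f0 : G -> H) (h : {set G} -> {set H}) :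
  bijective f0 -> {in components S &, injective h} ->
  {in components S, forall B : {set G},
    h B \in components (unpebbled b) /\ isomorphic_over a b B (h B)} ->
  exists2 f, pebbled_iso a b f S & saturated (unpebbled b) (f @: S).
Proof.
move=> bijf0 injh hP.
have /fin_all_exists[F FP] (B : {set G}) : exists f, B \in components S ->
    pebbled_iso a b f B /\ f @: B = h B.
  have [/hP[_ /asboolP[f isof fB]]|_] := boolP (B \in components S).
    by exists f.
  by exists f0.
pose f u := F (component S u) u.
have fF B u : B \in components S -> u \in B -> f u = F B u.
  by move=> BS uB; rewrite /f (component_of_mem BS uB).2.
have hU : {in components S, forall B : {set G},
    h B \in components (unpebbled b)}.
  by move=> B /hP[].
have imf : {in components S, forall B : {set G}, f @: B = h B}.
  by move=> B BS; rewrite -(FP B BS).2; apply: eq_in_imset => u; apply: fF.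
have injfB : {in components S, forall B : {set G}, {in B &, injective f}}.
  move=> B BS u v uB vB; have [[/bij_inj injF _ _] _] := FP B BS.
  by rewrite !(fF B) // => /injF.
have edgefB : {in components S, forall B : {set G}, edge_preserving f B}.
  move=> B BS u v uB vB; have [[_ edgeF _] _] := FP B BS.
  by rewrite !(fF B) ?edgeF.
have injf := glue_injective injh hU imf injfB.
have [g bijg gf] := extend_bijection (bij_eq_card bijf0) injf.
exists g; last by rewrite (eq_in_imset gf); apply: glue_saturated hU imf.
split=> // [u v uS vS|u uS].
  by rewrite !gf // (glue_edge_preserving injh hU imf edgefB).
have CS : component S u \in components S by rewrite componentsE imset_f.
by have [[_ _ profF] _] := FP _ CS; rewrite gf // profF ?mem_component.
Qed.

Lemma transferP k : transfer k.
Proof.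
elim: k => [|k IH] a b S eq_type satS tdS;
  have [f bijf _] := rank_type_bijection eq_type.
  move: tdS; rewrite leqn0 td_set_eq0 => /eqP ->; exists f.
    by split=> // u; rewrite inE.
  by rewrite imset0; split; [apply: sub0set | move=> ? ?; rewrite !inE].
have [h injh hP] := component_matching (transfer_rooted IH) eq_type satS tdS.
exact: glue_components bijf injh hP.
Qed.

Lemma rank_type_isomorphic d : td G <= d ->
  rank_type d.+1 ([::] : seq G) = rank_type d.+1 ([::] : seq H) ->
  isomorphic G H.
Proof.
move=> tdG eq_type; have satT : saturated (unpebbled [::]) [set: G].
  by split=> [|? ?]; [apply/subsetP => u; rewrite inE | rewrite !inE].
have [f [bijf edgef proff] _] := transferP eq_type satT tdG.
exists f; split=> // [u v|u]; first by rewrite edgef ?inE.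
by have [->] := proff u (in_setT u).
Qed.

End Transfer.

Theorem theorem30 (C : eqType) (d : nat) (d_ge1 : 1 <= d) (G : cgraph C)
    (tdG : td G <= d) :
  identifies (@C0 C d.+1) G.
Proof.
move=> H nGH; apply: contrapT => indistinguishable.
apply/nGH/(rank_type_isomorphic tdG)/funext => phi.
rewrite /rank_type /= !asg_nil.
case l: (layered _ 0 phi) => //=; apply/eqP/negPn/negP => ne.
case: indistinguishable; exists phi; split.
- exact: layered_C0 l.
- exact: layered_sentence l.
- by rewrite /models; move: ne; do 2!case: sat.
Qed.
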